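(* Let $A\in\mathbb{R}^{d\times d}$ be symmetric positive definite, $b\in\mathbb{R}^d$ and $f(x)=\frac12x^\top Ax-b^\top x$. Consider Frictionless Coordinate Hamiltonian Descent applied to $f$ with integration times $\{\eta_{k,i}\}$. (1) If $\eta_{k,i}=\frac{1}{\sqrt{A_{i,i}}}\sin^{-1}(1)$ for all $k$ and $i$, then Frictionless Coordinate Hamiltonian Descent is the Gauss-Seidel method, i.e. from any common initial point $x_1$ the two methods generate the same iterates. (2) Let $c\in(0,2)$. If $\eta_{k,i}=\frac{1}{\sqrt{A_{i,i}}}\cos^{-1}(1-c)$ for all $k$ and $i$, then Frictionless Coordinate Hamiltonian Descent is Successive Over-Relaxation with parameter $c$, i.e. from any common initial point $x_1$ the two methods generate the same iterates.
   Context: Notation: $\sin^{-1}(1)$ denotes any $\theta\in\mathbb{R}$ with $\sin\theta=1$, and $\cos^{-1}(1-c)$ any $\theta\in\mathbb{R}$ with $\cos\theta=1-c$. $x[i]$ is the $i$-th entry of $x$. Coordinate Hamiltonian Flow: $\mathsf{HF}^{(i)}_t(x_0,0)=(x_t,v_t)$ is the value at time $t$ of the solution of $\frac{dx}{dt}=v$, $\frac{dv}{dt}=-[\nabla f(x)]_i$ with $x(0)=x_0$, $v(0)=0$, where $[\nabla f(x)]_i\in\mathbb{R}^d$ is $\nabla f(x)$ with all entries except the $i$-th replaced by $0$. Frictionless Coordinate Hamiltonian Descent: from $x_1$, for $k=1,2,\dots$: set $x_k^{(0)}=x_k$; for $i=1,\dots,d$ compute $(x_k^{(i)},v_k^{(i)})=\mathsf{HF}^{(i)}_{\eta_{k,i}}(x_k^{(i-1)},0)$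 and set $x_{k+1}[i]=x_k^{(i)}[i]$. Let $\xi_{k,i}:=\frac{b_i-\sum_{j<i}A_{i,j}x_{k+1}[j]-\sum_{j>i}A_{i,j}x_k[j]}{A_{i,i}}$. Gauss-Seidel: for $i=1,\dots,d$ in order, $x_{k+1}[i]=\xi_{k,i}$. Successive Over-Relaxation with parameter $c$: for $i=1,\dots,d$ in order, $x_{k+1}[i]=c\,\xi_{k,i}+(1-c)x_k[i]$. *)

(* Defs.v *)
From mathcomp Require Import all_boot all_order all_algebra.
From mathcomp Require Import all_classical all_reals all_analysis.
Set Implicit Arguments.
Unset Strict Implicit.
Unset Printing Implicit Defensive.
Import Order.TTheory GRing.Theory Num.Theory.
Import numFieldNormedType.Exports.
Local Open Scope classical_set_scope.
Local Open Scope ring_scope.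

Definition posdef_mx (R : realType) (d : nat) (A : 'M[R]_d) : Prop :=
  A^T = A /\ forall x : 'cV[R]_d, x != 0 -> 0 < (x^T *m A *m x) 0 0.

Definition quadratic (R : realType) (d : nat) (A : 'M[R]_d) (b x : 'cV[R]_d)
    : R :=
  2^-1 * (x^T *m A *m x) 0 0 - (b^T *m x) 0 0.

Definition gradient (R : realType) (d : nat) (f : 'cV[R]_d -> R)
    (x : 'cV[R]_d) : 'cV[R]_d :=
  \col_j 'D_(delta_mx j 0) f x.

Definition keep_entry (R : realType) (d : nat) (i : 'I_d) (g : 'cV[R]_d)
    : 'cV[R]_d :=
  \col_j (if j == i then g j 0 else 0).

Definition set_entry (R : realType) (d : nat) (x : 'cV[R]_d) (i : 'I_d)
    (a : R) : 'cV[R]_d :=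
  \col_j (if j == i then a else x j 0).

(* The flow is solved on the whole real line, so that the integration time may
   be negative. *)
Definition is_coord_flow (R : realType) (d : nat) (f : 'cV[R]_d -> R)
    (i : 'I_d) (x0 v0 : 'cV[R]_d) (xv : (R -> 'cV[R]_d) * (R -> 'cV[R]_d))
    : Prop :=
  [/\ xv.1 0 = x0,
      xv.2 0 = v0,
      forall t : R, is_derive t (1 : R) xv.1 (xv.2 t)
    & forall t : R,
        is_derive t (1 : R) xv.2 (- keep_entry i (gradient f (xv.1 t)))].

(* [get P] chooses an element of [P], and is an unspecified default value when
   [P] is empty: nothing can be derived about [coord_HF] without existence of a
   solution of the initial value problem, nor its value be computed without
   uniqueness. *)
Definition coord_HF (R : realType) (d : nat) (f : 'cV[R]_d -> R) (i : 'I_d)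
    (t : R) (x0 v0 : 'cV[R]_d) : 'cV[R]_d * 'cV[R]_d :=
  let xv := get (is_coord_flow f i x0 v0) in (xv.1 t, xv.2 t).

(* In all the sweeps below [enum 'I_d] lists the coordinates in increasing
   order.  In [fchd_sweep], the first component of the state is the
   intermediate point x_k^(i) and the second one the vector x_{k+1} being
   filled, whose entries are all eventually overwritten. *)
Definition fchd_sweep (R : realType) (d : nat) (f : 'cV[R]_d -> R)
    (eta : 'I_d -> R) (x : 'cV[R]_d) : 'cV[R]_d :=
  (foldl (fun (s : 'cV[R]_d * 'cV[R]_d) (i : 'I_d) =>
            let x' := (coord_HF f i (eta i) s.1 0).1 in
            (x', set_entry s.2 i (x' i 0)))
         (x, x) (enum 'I_d)).2.

(* For the three methods the iterates are numbered from 0: index [k] is the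
   iterate x_{k+1}, and [eta k] are the integration times of the sweep that
   leads from it to the next iterate. *)
Fixpoint fchd (R : realType) (d : nat) (f : 'cV[R]_d -> R)
    (eta : nat -> 'I_d -> R) (x1 : 'cV[R]_d) (k : nat) : 'cV[R]_d :=
  if k is k'.+1 then fchd_sweep f (eta k') (fchd f eta x1 k') else x1.

(* [x] is the current iterate, [y] the next one, of which only the entries
   before [i] are read. *)
Definition xi (R : realType) (d : nat) (A : 'M[R]_d) (b x y : 'cV[R]_d)
    (i : 'I_d) : R :=
  (b i 0 - \sum_(j < d | (j < i)%N) A i j * y j 0
         - \sum_(j < d | (i < j)%N) A i j * x j 0) / A i i.

Definition gauss_seidel_sweep (R : realType) (d : nat) (A : 'M[R]_d)
    (b x : 'cV[R]_d) : 'cV[R]_d :=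
  foldl (fun y i => set_entry y i (xi A b x y i)) x (enum 'I_d).

Definition gauss_seidel (R : realType) (d : nat) (A : 'M[R]_d)
    (b x1 : 'cV[R]_d) (k : nat) : 'cV[R]_d :=
  iter k (gauss_seidel_sweep A b) x1.

Definition sor_sweep (R : realType) (d : nat) (c : R) (A : 'M[R]_d)
    (b x : 'cV[R]_d) : 'cV[R]_d :=
  foldl (fun y i => set_entry y i (c * xi A b x y i + (1 - c) * x i 0))
        x (enum 'I_d).

Definition sor (R : realType) (d : nat) (c : R) (A : 'M[R]_d)
    (b x1 : 'cV[R]_d) (k : nat) : 'cV[R]_d :=
  iter k (sor_sweep c A b) x1.

(* Main.v *)
(** Along coordinate [i] the flow is a harmonic oscillator of frequency
    [w = sqrt (A i i)] started at rest, whose unique solution is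
    [x_i(t) = x_i(0) + r / A i i * (cos (w t) - 1)] with
    [r = (A x(0) - b)_i].  For [cos (w t) = 1 - c] the coordinate moves by
    [- c r / A i i], which is one step of over-relaxation; Gauss-Seidel is the
    case [c = 1], since [sin theta = 1] forces [cos theta = 0]. *)

Require Import Defs.
From mathcomp Require Import all_boot all_order all_algebra.
From mathcomp Require Import all_classical all_reals all_analysis.
From mathcomp Require Import ring.
Import Order.TTheory GRing.Theory Num.Theory.
Import numFieldNormedType.Exports.
Local Open Scope ring_scope.

(** * Entrywise derivatives and the scalar oscillator *)

Lemma is_derive_mxP (R : realType) (m n : nat) (X : R -> 'M[R]_(m, n)) (t : R)
    (dX : 'M[R]_(m, n)) :
  is_derive t (1 : R) X dX <->
  forall i j, is_derive t (1 : R) (fun s => X s i j) (dX i j).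
Proof.
split=> [[dXt <-] i j|dXt].
  rewrite derive_mx // mxE; apply: derivableP.
  exact: (derivable_mxP _ _ _).1 dXt i j.
have dvX : derivable X t 1.
  by apply/derivable_mxP => i j; apply: ex_derive.
split=> //; rewrite derive_mx //; apply/matrixP => i j.
by rewrite mxE derive_val.
Qed.

(** Serves [f = cos] and [f = sin]: each entry of the explicit flow has the shape
    [p + q * f (w * s)]. *)
Lemma is_derive_affine (R : realType) (f : R -> R) (w p q t df : R) :
  is_derive (w * t) (1 : R) f df ->
  is_derive t (1 : R) (fun s => p + q * f (w * s)) (q * (w * df)).
Proof.
move=> dfwt.
have dw : is_derive t (1 : R) (fun s => w * s) w.
  apply: (@is_derive_eq _ _ _ (w \*: id)).
  by rewrite /GRing.scale /= mulr1.
have dfw : is_derive t (1 : R) (f \o (fun s => w * s)) (df * w).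
  exact: is_derive1_comp.
apply: (@is_derive_eq _ _ _ (cst p + q \*: (f \o (fun s => w * s)))).
by rewrite add0r [df * w]mulrC.
Qed.

Lemma harmonic_oscillator_uniq (R : realType) (a : R) (u p : R -> R) :
  0 < a ->
  (forall t, is_derive t (1 : R) u (p t)) ->
  (forall t, is_derive t (1 : R) p (- (a * u t))) ->
  u 0 = 0 -> p 0 = 0 -> forall t, u t = 0.
Proof.
move=> a_gt0 du dp u0 p0 t.
(* The energy [p^2 + a u^2] is conserved. *)
pose E : R -> R := p ^+ 2 + a \*: (u ^+ 2).
have dE s : is_derive s (1 : R) E 0.
  have dus := du s; have dps := dp s.
  apply: is_derive_eq.
  rewrite /GRing.scale /=; ring.
have EE s : E s = p s ^+ 2 + a * u s ^+ 2 by [].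
have /eqP : E t = 0.
  by rewrite (@is_derive_0_is_cst _ E t 0 dE) EE u0 p0 expr0n mulr0 addr0.
rewrite EE paddr_eq0 ?sqr_ge0 //; last by rewrite mulr_ge0 ?sqr_ge0 // ltW.
by case/andP=> _; rewrite mulf_eq0 gt_eqF //= sqrf_eq0 => /eqP.
Qed.

(** Symmetry of [A] makes the two cross terms of the expanded quadratic form equal, which absorbs
    the factor 1/2. *)
Lemma gradient_quadratic (R : realType) (d : nat) (A : 'M[R]_d) (b x : 'cV[R]_d) :
  A^T = A -> gradient (quadratic A b) x = A *m x - b.
Proof.
move=> symA; apply/colP => j; rewrite mxE.
set v := delta_mx j 0.
set g := (A *m x - b) j 0.
have vM (y : 'cV[R]_d) : (v^T *m y) 0 0 = y j 0.
  by rewrite /v trmx_delta -rowE mxE.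
have Mv (y : 'cV[R]_d) : (y^T *m v) 0 0 = y j 0.
  transitivity ((y^T *m v)^T 0 0); first by rewrite [RHS]mxE.
  by rewrite trmx_mul trmxK vM.
have xAv : (x^T *m A *m v) 0 0 = (A *m x) j 0.
  by rewrite -{1}symA -trmx_mul Mv.
(* Since the function is quadratic, its difference quotient along [v] is exactly affine in [h], with
   value [g] at [h = 0]. *)
have dq (h : R) : h != 0 ->
    h^-1 *: ((quadratic A b \o shift x) (h *: v) - quadratic A b x) =
    g + h * (2^-1 * (v^T *m A *m v) 0 0).
  move=> h0; rewrite /quadratic /= /shift /=.
  have -> : (h *: v + x)^T = h *: v^T + x^T by rewrite linearD linearZ.
  rewrite !(mulmxDl, mulmxDr) -!scalemxAl -!scalemxAr.
  have e (p q : 'M[R]_1) : (p + q) 0 0 = p 0 0 + q 0 0 by rewrite mxE.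
  have ez (p : 'M[R]_1) k : (k *: p) 0 0 = k * p 0 0 by rewrite mxE.
  rewrite !(e, ez) xAv Mv -(mulmxA v^T A x) vM /g [X in _ = X + _]mxE.
  rewrite [X in _ = _ + X + _]mxE /GRing.scale /=.
  by field.
set K := 2^-1 * _ in dq.
have gK : ((fun h : R => g + h * K) @ (0 : R) --> g)%classic.
  have gE : g = g + 0 * K by rewrite mul0r addr0.
  rewrite [X in (_ --> X)%classic]gE; apply: cvgD; first exact: cvg_cst.
  by apply: cvgM; [exact: cvg_id | exact: cvg_cst].
apply/cvg_lim => //.
(* The derivative is a limit over the punctured neighbourhood, the only place where the formula [dq]
   applies. *)
have gK' : ((fun h : R => g + h * K) @ 0^' --> g)%classic.
  exact: cvg_within_filter gK.
apply: cvg_trans gK'.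
apply: near_eq_cvg; rewrite near_withinE /=.
by near=> h => h0 /=; rewrite -dq.
Unshelve. all: by end_near. Qed.

(** * The flow along one coordinate: existence, uniqueness, closed form *)

Section CoordinateFlow.
Context {R : realType} {d : nat}.
Variables (A : 'M[R]_d) (b : 'cV[R]_d).
Hypothesis posA : posdef_mx A.

Lemma posdef_diag_gt0 (i : 'I_d) : 0 < A i i.
Proof.
have [_ /(_ (delta_mx i 0))] := posA.
rewrite trmx_delta -rowE -colE !mxE; apply.
apply/eqP => /matrixP /(_ i 0).
by rewrite !mxE !eqxx => /eqP; rewrite oner_eq0.
Qed.

Let w i := Num.sqrt (A i i).

(** Only entry [i] moves, so along this curve the residual [(A *m x - b) i 0] is
    [r * cos (w i * t)], with [r] its initial value; this is the force that the second equation
    requires. *)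
Lemma coord_flow_exists (i : 'I_d) (x0 : 'cV[R]_d) :
  is_coord_flow (quadratic A b) i x0 0
    (fun t => x0 +
       (((A *m x0 - b) i 0 / A i i) * (cos (w i * t) - 1)) *: delta_mx i 0,
     fun t => (- ((A *m x0 - b) i 0 / w i) * sin (w i * t)) *: delta_mx i 0).
Proof.
have a0 := posdef_diag_gt0 i.
have w0 : 0 < w i by rewrite sqrtr_gt0.
have wE : A i i = w i ^+ 2 by rewrite sqr_sqrtr ?ltW.
have wn0 : w i != 0 by rewrite gt_eqF.
set r := (A *m x0 - b) i 0.
split=> /= [||t|t].
- by rewrite mulr0 cos0 subrr mulr0 scale0r addr0.
- by rewrite mulr0 sin0 mulr0 scale0r.
- apply/is_derive_mxP => k l; rewrite !mxE.
  under eq_fun => s do rewrite !mxE.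
  (* [c] is the entry of [delta_mx i 0], equal to 0 or 1; the identities below are linear in it, so
     [ring] and [field] treat it as an atom. *)
  set c := (_%:R : R).
  rewrite [F in is_derive _ _ F _](_ : _ =
    fun s => (x0 k l - r / A i i * c) + r / A i i * c * cos (w i * s));
    last first.
    by apply/funext => s; ring.
  apply: (@is_derive_eq _ _ _ _ _ _ _ _
    (is_derive_affine _ _ _ _ _ _ _ (is_derive_cos _))).
  by rewrite wE; field.
- apply/is_derive_mxP => k l; rewrite gradient_quadratic; last by case: posA.
  rewrite mulmxDr -scalemxAr -colE !mxE.
  under eq_fun => s do rewrite !mxE.
  rewrite (ord1 l) [in X in is_derive _ _ X _]eqxx andbT.
  rewrite [F in is_derive _ _ F _](_ : _ =
    fun s => 0 + - (r / w i * (k == i)%:R) * sin (w i * s)); last first.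
    by apply/funext => s; ring.
  apply: (@is_derive_eq _ _ _ _ _ _ _ _
    (is_derive_affine _ _ _ _ _ _ _ (is_derive_sin _))).
  have rE : r = (A *m x0) i 0 - b i 0 by rewrite /r !mxE.
  case: eqP => [->|_] /=; last by ring.
  have AE : (A *m x0) i 0 = r + b i 0 by rewrite rE; ring.
  rewrite !mxE in AE *.
  by rewrite AE wE; field.
Qed.

(** The difference [z] of two solutions solves the homogeneous problem, where [b] has cancelled,
    with zero initial position and velocity. Positions are compared because they are what a sweep
    reads. *)
Lemma coord_flow_uniq (i : 'I_d) (x0 : 'cV[R]_d)
    (xv yw : (R -> 'cV[R]_d) * (R -> 'cV[R]_d)) :
  is_coord_flow (quadratic A b) i x0 0 xv ->
  is_coord_flow (quadratic A b) i x0 0 yw -> xv.1 = yw.1.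
Proof.
case: xv yw => [x v] [y u] [/= x0E v0 dx dv] [/= y0E u0 dy du].
have symA : A^T = A by case: posA.
pose z t := x t - y t; pose p t := v t - u t.
have dz (t : R) : is_derive t (1 : R) z (p t) by exact: is_deriveB.
have dp (t : R) : is_derive t (1 : R) p (- keep_entry i (A *m z t)).
  apply: (@is_derive_eq _ _ _ _ _ _ _ _ (is_deriveB (dv t) (du t))).
  rewrite !gradient_quadratic //; apply/colP => k; rewrite /z mulmxBr !mxE.
  by case: ifP => _; ring.
have z0 : z 0 = 0 by rewrite /z x0E y0E subrr.
have p0 : p 0 = 0 by rewrite /p v0 u0 subrr.
have dzk k t : is_derive t (1 : R) (fun s => z s k 0) (p t k 0).
  exact: (is_derive_mxP _ _ _ _ _ _).1 (dz t) k 0.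
have dpk k t := (is_derive_mxP _ _ _ _ _ _).1 (dp t) k 0.
(* Off coordinate [i] the force is zero: the velocity stays 0, hence so does the position. *)
have zk k t : k != i -> z t k 0 = 0.
  move=> ki.
  have pk s : p s k 0 = 0.
    have dp0 r : is_derive r (1 : R) (fun s => p s k 0) 0.
      by have := dpk k r; rewrite !mxE (negbTE ki) oppr0.
    by rewrite (is_derive_0_is_cst s 0 dp0) p0 mxE.
  have dz0 r : is_derive r (1 : R) (fun s => z s k 0) 0.
    by rewrite -(pk r); exact: dzk.
  by rewrite (is_derive_0_is_cst t 0 dz0) z0 mxE.
(* With the other entries zero, row [i] of [A *m z t] reduces to [A i i * z t i 0], and a scalar
   oscillator remains. *)
have zi t : z t i 0 = 0.
  apply: (harmonic_oscillator_uniq _ _ _ _ (posdef_diag_gt0 i) (dzk i)).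
  - move=> s; have := dpk i s; rewrite mxE [keep_entry _ _ _ _]mxE eqxx mxE.
    rewrite (bigD1 i) //= big1 ?addr0 // => k ki.
    by rewrite zk // mulr0.
  - by rewrite z0 mxE.
  - by rewrite p0 mxE.
apply/funext => t; apply/colP => k; apply/eqP; rewrite -subr_eq0; apply/eqP.
have -> : x t k 0 - y t k 0 = z t k 0 by rewrite !mxE.
by have [->|/zk->] := eqVneq k i.
Qed.

(** By existence [get] returns a solution, by uniqueness its position is the explicit one; the
    factor [(Num.sqrt (A i i))^-1] of the time cancels the frequency. *)
Lemma coord_HF_quadratic (i : 'I_d) (theta : R) (x0 : 'cV[R]_d) :
  (coord_HF (quadratic A b) i ((Num.sqrt (A i i))^-1 * theta) x0 0).1 =
  set_entry x0 i
    (x0 i 0 + (A *m x0 - b) i 0 / A i i * (cos theta - 1)).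
Proof.
rewrite /coord_HF /=.
have ex := coord_flow_exists i x0.
rewrite (coord_flow_uniq _ _ _ _ (getI ex) ex).
rewrite /= /w mulVKf ?gt_eqF ?sqrtr_gt0 ?posdef_diag_gt0 //.
apply/colP => k; rewrite !mxE.
by case: eqP => [->|_] /=; rewrite ?mulr1 ?mulr0 ?addr0.
Qed.

Lemma fchd_sweep_sor (c : R) (eta : 'I_d -> R) (x : 'cV[R]_d) :
  (forall i, exists2 theta : R,
     cos theta = 1 - c & eta i = (Num.sqrt (A i i))^-1 * theta) ->
  fchd_sweep (quadratic A b) eta x = sor_sweep c A b x.
Proof.
move=> etaE; rewrite /fchd_sweep /sor_sweep.
set F := (F in (foldl F _ _).2); set G := (G in _ = foldl G _ _).
(* Before step [i] no entry of index at least [i] has been modified, so the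
   entries of the old and of the new iterate read by [xi] are those of [y]. *)
suff fold_eq s (y : 'cV[R]_d) : pairwise (fun i j : 'I_d => (i < j)%N) s ->
    (forall i j : 'I_d, i \in s -> (i <= j)%N -> y j 0 = x j 0) ->
    (foldl F (y, y) s).2 = foldl G y s.
  apply: fold_eq => //.
  rewrite -sorted_pairwise; last by move=> i j k; apply: ltn_trans.
  by have := iota_ltn_sorted 0 d; rewrite -val_enum_ord sorted_map.
elim: s y => //= i s IHs y /andP[/allP lt_i s_sorted] yx.
(* The state stays on the diagonal: the flow alters entry [i] alone, so the intermediate point and
   the vector being filled remain equal. *)
have -> : F (y, y) i = (G y i, G y i); last first.
  apply: IHs => // j k js jk; rewrite /G mxE.
  have ltik : (i < k)%N := leq_trans (lt_i j js) jk.
  case: eqP => [kE|_]; first by rewrite kE ltnn in ltik.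
  by apply: (yx j) => //; rewrite in_cons js orbT.
have [theta cosE eta_i] := etaE i.
have yxi (k : 'I_d) : (i <= k)%N -> y k 0 = x k 0 by apply: yx; rewrite mem_head.
have entry_i a : set_entry y i a i 0 = a by rewrite mxE eqxx.
rewrite /F eta_i coord_HF_quadratic cosE [(y, y).1]/= [(y, y).2]/= entry_i.
suff -> : y i 0 + (A *m y - b) i 0 / A i i * (1 - c - 1) =
          c * xi A b x y i + (1 - c) * x i 0 by [].
have a0 : A i i != 0 by rewrite gt_eqF ?posdef_diag_gt0.
(* Row [i] splits into the diagonal term, the entries already updated, and the later ones, which are
   still those of [x]. *)
have AyE : (A *m y) i 0 = A i i * y i 0 +
    (\sum_(j < d | (j < i)%N) A i j * y j 0 +
     \sum_(j < d | (i < j)%N) A i j * x j 0).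
  rewrite mxE (bigD1 i) //= (bigID (fun j : 'I_d => (j < i)%N)) /=.
  congr (_ + (_ + _)).
    by apply: eq_bigl => j; rewrite -val_eqE /=; case: ltngtP.
  apply: eq_big => [j|j /andP[_]]; first by rewrite -val_eqE /=; case: ltngtP.
  by rewrite -leqNgt => /yxi ->.
have resE : (A *m y - b) i 0 = (A *m y) i 0 - b i 0 by rewrite !mxE.
by rewrite /xi -(yxi i) // resE AyE; field.
Qed.

End CoordinateFlow.

Theorem theorem3 (R : realType) (d : nat) (A : 'M[R]_d) (b : 'cV[R]_d)
    (eta : nat -> 'I_d -> R) :
  posdef_mx A ->
  ((forall (k : nat) (i : 'I_d), exists2 theta : R,
       sin theta = 1 & eta k i = (Num.sqrt (A i i))^-1 * theta) ->
     forall (x1 : 'cV[R]_d) (k : nat),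
       fchd (quadratic A b) eta x1 k = gauss_seidel A b x1 k)
  /\
  (forall c : R, 0 < c < 2 ->
     (forall (k : nat) (i : 'I_d), exists2 theta : R,
         cos theta = 1 - c & eta k i = (Num.sqrt (A i i))^-1 * theta) ->
     forall (x1 : 'cV[R]_d) (k : nat),
       fchd (quadratic A b) eta x1 k = sor c A b x1 k).
Proof.
move=> posA.
have fchd_sor c :
    (forall (k : nat) (i : 'I_d), exists2 theta : R,
         cos theta = 1 - c & eta k i = (Num.sqrt (A i i))^-1 * theta) ->
    forall (x1 : 'cV[R]_d) (k : nat),
      fchd (quadratic A b) eta x1 k = sor c A b x1 k.
  move=> etaE x1; elim=> //= k ->.
  by rewrite (fchd_sweep_sor _ _ posA _ _ _ (etaE k)).
split=> [etaE x1 k|c _]; last exact: fchd_sor.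
rewrite (fchd_sor 1) => [|{}k i]; last first.
  have [theta sin1 ->] := etaE k i; exists theta => //.
  by apply/eqP; rewrite subrr -sqrf_eq0 cos2sin2 sin1 expr1n subrr.
(* At [c = 1] the old entry has weight 0, so the two update rules coincide. *)
rewrite /sor /gauss_seidel; apply: eq_iter => y.
rewrite /sor_sweep /gauss_seidel_sweep.
congr foldl; apply/funext => z; apply/funext => i.
by rewrite subrr mul0r addr0 mul1r.
Qed.
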